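(* Let $\mathfrak{P}_0$ be a convex subset of the set $\mathfrak{P}_n$ of $n$-variate probability distributions with the property $$\Delta^\pm(\bar p,\bar q)\in\mathfrak{P}_0\quad\text{for any }\bar p,\bar q\in\mathfrak{P}_0\text{ such that }\bar p\ne\bar q,$$ where $\Delta^+(\bar p,\bar q)$ and $\Delta^-(\bar p,\bar q)$ are the $n$-variate probability distributions with the entries $c[p_{i_1,\dots,i_n}-q_{i_1,\dots,i_n}]_+$ and $c[q_{i_1,\dots,i_n}-p_{i_1,\dots,i_n}]_+$, $c=1/\mathrm{TV}(\bar p,\bar q)$, $[x]_+=\max\{x,0\}$. Let $\mathcal{S}=\{E_i\}_{i=1}^{+\infty}$ be a nondecreasing sequence of nonnegative numbers such that $E_1=0$ and $\sum_{i=1}^{+\infty}e^{-\beta E_i}<+\infty$ for all $\beta>0$. Let $\varepsilon>0$. A) If $f$ is a function in $T^1_n(C,D|\mathfrak{P}_0)$ then $$|f(\bar p)-f(\bar q)|\le C\varepsilon F_{\mathcal{S}}(E/\varepsilon)+Dg(\varepsilon)$$ for any distributions $\bar p,\bar q\in\mathfrak{P}_0$ such that $\sum_{i=1}^{+\infty}E_i[\bar p_1]_i\le E$, $\sum_{i=1}^{+\infty}E_i[\bar q_1]_i\le E$ and $\mathrm{TV}(\bar p,\bar q)\le\varepsilon$, where $[\bar p_1]_i$ denotes the $i$-th entry of the marginal distribution $\bar p_1$. B) If $f$ is a nonnegative function in $T^1_n(C,D|\mathfrak{P}_0)$ and $\bar p$ is a distribution in $\mathfrak{P}_0$ such that $\sum_{i=1}^{+\infty}E_i[\bar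 p_1]_i\le E$, then $$f(\bar p)-f(\bar q)\le C\varepsilon F_{\mathcal{S}}\big((E-E_\varepsilon(\bar p))/\varepsilon\big)+Dg(\varepsilon)\le C\varepsilon F_{\mathcal{S}}(E/\varepsilon)+Dg(\varepsilon)$$ for any distribution $\bar q\in\mathfrak{P}_0$ such that $\mathrm{TV}(\bar p,\bar q)\le\varepsilon$, where $$E_\varepsilon(\bar p)=\sum_{i=1}^{+\infty}E_i[\bar p^{\varepsilon}_1]_i,\qquad[\bar p^\varepsilon_1]_i=\sum_{i_2,\dots,i_n}[p_{i,i_2,\dots,i_n}-\varepsilon]_+,$$ and the left-hand side may be equal to $-\infty$.
   Context: $\mathfrak{P}_n$ is the set of probability distributions $\bar p=\{p_{i_1,\dots,i_n}\}_{(i_1,\dots,i_n)\in\mathbb{N}^n}$ on $\mathbb{N}^n$, $\mathbb{N}=\{1,2,\dots\}$. $\bar p_1$ denotes the marginal distribution of $\bar p$ corresponding to the first component. $\mathrm{TV}(\bar p,\bar q)=\frac12\sum_{i_1,\dots,i_n}|p_{i_1,\dots,i_n}-q_{i_1,\dots,i_n}|$. $H(\{r_i\})=-\sum_ir_i\ln r_i\in[0,+\infty]$ is the Shannon entropy, $h_2(\lambda)=-\lambda\ln\lambda-(1-\lambda)\ln(1-\lambda)$ the binary entropy, $g(x)=(x+1)\ln(x+1)-x\ln x$ for $x>0$, $g(0)=0$, and $$F_{\mathcal{S}}(E)=\sup\Big\{H(\{p_i\})\,:\,\{p_i\}\in\mathfrak{P}_1,\ \sum_{i=1}^{+\infty}E_ip_i\le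 E\Big\}.$$ Class $T^1_n(C,D|\mathfrak{P}_0)$: all functions $f:\mathfrak{P}_0\to(-\infty,+\infty]$ for which there are nonnegative numbers $c_f^\pm,d_f^\pm$ with $c_f^-+c_f^+=C$, $d_f^-+d_f^+=D$ such that for all $\bar p,\bar q\in\mathfrak{P}_0$, $\lambda\in[0,1]$ $$\lambda f(\bar p)+(1-\lambda)f(\bar q)-d_f^-h_2(\lambda)\le f(\lambda\bar p+(1-\lambda)\bar q)\le\lambda f(\bar p)+(1-\lambda)f(\bar q)+d_f^+h_2(\lambda),$$ $$-c_f^-H(\bar p_1)\le f(\bar p)\le c_f^+H(\bar p_1),$$ with possible infinite values in all sides (convention $0\cdot(+\infty)=0$). *)

(* Defs.v *)
From mathcomp Require Import all_boot all_order all_algebra.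
From mathcomp Require Import all_classical all_reals all_analysis.

Set Implicit Arguments.
Unset Strict Implicit.
Unset Printing Implicit Defensive.

Import Order.TTheory GRing.Theory Num.Theory.

Local Open Scope classical_set_scope.
Local Open Scope ring_scope.
Local Open Scope ereal_scope.

(* Indices start at 0: [i : nat] stands for the index i + 1 of N = {1, 2, ...}.
   The index set N^n, n >= 1, is written [n.+1.-tuple nat], and N^1 is
   identified with [nat]. *)

Definition is_distr (R : realType) (I : choiceType) (p : I -> R) : Prop :=
  (forall i, (0 <= p i)%R) /\ \esum_(i in [set: I]) (p i)%:E = 1.

(* The [fine] is harmless on absolutely summable [p] and [q]. *)
Definition TV (R : realType) (I : choiceType) (p q : I -> R) : R :=
  (2^-1 * fine (\esum_(i in [set: I]) `|p i - q i|%:E))%R.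

(* Delta^+(p, q); Delta^-(p, q) is [jordan_part q p], as TV is symmetric. *)
Definition jordan_part (R : realType) (I : choiceType) (p q : I -> R) :
  I -> R := fun i => ((TV p q)^-1 * Num.max (p i - q i) 0)%R.

(* Also applied to nonnegative summable arrays that are not normalized. *)
Definition marginal1 (R : realType) (n : nat) (p : n.+1.-tuple nat -> R) :
  nat -> R := fun i => fine (\esum_(t in [set t | thead t = i]) (p t)%:E).

(* Since [ln 0 = 0], the convention 0 ln 0 = 0 is built in here and below. *)
Definition entropy (R : realType) (p : nat -> R) : \bar R :=
  \sum_(0 <= i <oo) (- (p i * ln (p i)))%:E.

Definition h2 (R : realType) (lam : R) : R :=
  (- (lam * ln lam) - (1 - lam) * ln (1 - lam))%R.

Definition gfun (R : realType) (x : R) : R :=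
  ((x + 1) * ln (x + 1) - x * ln x)%R.

Definition energy (R : realType) (S : R^nat) (p : nat -> R) : \bar R :=
  \sum_(0 <= i <oo) (S i * p i)%:E.

Definition FS (R : realType) (S : R^nat) (E : \bar R) : \bar R :=
  ereal_sup [set entropy p | p in [set p | is_distr p /\ energy S p <= E]].

(* The array with entries [p_{i_1,...,i_n} - eps]_+ *)
Definition cutoff (R : realType) (I : choiceType) (eps : R) (p : I -> R) :
  I -> R := fun i => Num.max (p i - eps)%R 0%R.

Definition Eeps (R : realType) (n : nat) (S : R^nat) (eps : R)
    (p : n.+1.-tuple nat -> R) : \bar R :=
  energy S (marginal1 (cutoff eps p)).

Definition mix (R : realType) (I : choiceType) (lam : R) (p q : I -> R) :
  I -> R := fun i => (lam * p i + (1 - lam) * q i)%R.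

(* The class T^1_n(C, D | P0).  Only the values of [f] on [P0] matter; they lie
   in ]-oo, +oo], so no sum +oo - oo occurs, and 0 * +oo = 0 in [\bar R]. *)
Definition T1class (R : realType) (n : nat) (C D : R)
    (P0 : set (n.+1.-tuple nat -> R))
    (f : (n.+1.-tuple nat -> R) -> \bar R) : Prop :=
  (forall p, P0 p -> f p != -oo) /\
  exists cm cp dm dp : R,
    [/\ (0 <= cm)%R, (0 <= cp)%R, (0 <= dm)%R & (0 <= dp)%R] /\
    (cm + cp)%R = C /\ (dm + dp)%R = D /\
    (forall p q (lam : R), P0 p -> P0 q -> (0 <= lam <= 1)%R ->
      lam%:E * f p + (1 - lam)%:E * f q - (dm * h2 lam)%:E
        <= f (mix lam p q) /\
      f (mix lam p q)
        <= lam%:E * f p + (1 - lam)%:E * f q + (dp * h2 lam)%:E) /\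
    (forall p, P0 p ->
      - (cm%:E * entropy (marginal1 p)) <= f p /\
      f p <= cp%:E * entropy (marginal1 p)).

(* Main.v *)
(* With [d = TV p q] and [r+ = Delta^+(p, q)], [r- = Delta^-(p, q)], the mixtures
   [(p + d r-) / (1 + d)] and [(q + d r+) / (1 + d)] coincide.  The two almost
   affinity inequalities at this common point give
   [f p - f q <= d (f r+ - f r-) + D g(d)], and [f r+], [- f r-] are bounded by
   entropies of first marginals.  Since [[p - q]_+ <= p - [p - eps]_+], the
   energy of [r+] is at most [(E - E_eps(p)) / d].  Mixing with the point mass
   at the zero-energy index shows that [d F_S(X / d)] is nondecreasing in [d],
   which replaces [d] by [eps].  Gibbs' inequality makes all the entropies
   involved finite. *)

Require Import Defs.
From mathcomp Require Import all_boot all_order all_algebra.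
From mathcomp Require Import all_classical all_reals all_analysis.
From mathcomp Require Import ring lra.

Import Order.TTheory GRing.Theory Num.Theory.

Local Open Scope classical_set_scope.
Local Open Scope ring_scope.
Local Open Scope ereal_scope.

(** * Elementary inequalities for [x ln x], [gfun] and [h2] *)

(** This is [ln z <= z - 1] at [z = y / x], multiplied by [x]. Convexity, monotonicity of [gfun] and
    Gibbs' inequality all come from it. *)
Lemma ge_sub_xlnxy (R : realType) (x y : R) : (0 <= x)%R -> (0 < y)%R ->
  (x - y <= x * (ln x - ln y))%R.
Proof.
move=> x0 y0; have [->|xn0] := eqVneq x 0%R; first by rewrite mul0r; lra.
have {xn0}x0 : (0 < x)%R by rewrite lt_neqAle eq_sym xn0.
have yx0 : (0 < y / x)%R by rewrite divr_gt0.
have /le_ln1Dx : (-1 < y / x - 1)%R by lra.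
rewrite addrC subrK ln_div ?posrE// => h.
have := ler_wpM2l (ltW x0) h.
have -> : (x * (y / x - 1) = y - x)%R by field; rewrite gt_eqF.
lra.
Qed.

(** Add the tangent inequalities at the mean [m] with weights [t] and [1 - t]; their linear terms
    cancel. *)
Lemma convex_xlnx (R : realType) (t x y : R) : (0 <= t <= 1)%R ->
  (0 <= x)%R -> (0 <= y)%R ->
  ((t * x + (1 - t) * y) * ln (t * x + (1 - t) * y)
    <= t * (x * ln x) + (1 - t) * (y * ln y))%R.
Proof.
move=> /andP[t0 t1] x0 y0.
set m := (t * x + (1 - t) * y)%R; have t1' : (0 <= 1 - t)%R by rewrite subr_ge0.
have tx0 : (0 <= t * x)%R by rewrite mulr_ge0.
have ty0 : (0 <= (1 - t) * y)%R by rewrite mulr_ge0.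
have [m0|mn0] := eqVneq m 0%R.
  have [tx ty] : (t * x = 0 /\ (1 - t) * y = 0)%R by rewrite /m in m0; lra.
  by rewrite m0 mul0r !mulrA tx ty !mul0r addr0.
have m_gt0 : (0 < m)%R by rewrite lt_neqAle eq_sym mn0 addr_ge0.
have := ler_wpM2l t0 (ge_sub_xlnxy _ _ _ x0 m_gt0).
have := ler_wpM2l t1' (ge_sub_xlnxy _ _ _ y0 m_gt0).
have -> : (m * ln m = t * x * ln m + (1 - t) * y * ln m)%R.
  by rewrite -mulrDl.
have : (t * (x - m) + (1 - t) * (y - m) = 0)%R by rewrite /m; ring.
move: (ln m) (ln x) (ln y) => a b c; lra.
Qed.

Lemma gfun_ge0 (R : realType) (x : R) : (0 < x)%R -> (0 <= gfun x)%R.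
Proof.
move=> x0; rewrite /gfun.
have lnx : (ln x <= ln (x + 1))%R by rewrite ler_ln ?posrE//; lra.
have ln1x : (0 <= ln (x + 1))%R by rewrite ln_ge0//; lra.
have := ler_wpM2l (ltW x0) lnx; lra.
Qed.

(** A derivative-free argument: write [gfun x] as [x (ln (x + 1) - ln x) + ln (x + 1)] and compare
    the first summands. *)
Lemma le_gfun (R : realType) (x y : R) : (0 < x)%R -> (x <= y)%R ->
  (gfun x <= gfun y)%R.
Proof.
move=> x0 xy; have y0 := lt_le_trans x0 xy.
have lnxy : (ln (x + 1) <= ln (y + 1))%R by rewrite ler_ln ?posrE//; lra.
(* [- ln m] is the slope of [gfun] at [y]. The tangent inequalities for the pairs [(1, m)] and
   [(x, (x + 1) m)] combine because [(y - x)(1 - m) = (x + 1) m - x]. *)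
pose m := (y / (y + 1))%R.
have y10 : (0 < y + 1)%R by lra.
have m0 : (0 < m)%R by rewrite divr_gt0.
have lnm : (ln m = ln y - ln (y + 1))%R by rewrite ln_div ?posrE.
have h1 := ge_sub_xlnxy _ _ _ ler01 m0.
have x10 : (0 < x + 1)%R by lra.
have h2 := ge_sub_xlnxy _ _ _ (ltW x0) (mulr_gt0 x10 m0).
have lnxm : (ln ((x + 1) * m) = ln (x + 1) + ln m)%R by rewrite lnM ?posrE.
move: h1 h2; rewrite ln1 lnxm lnm => h1 h2.
have yx0 : (0 <= y - x)%R by rewrite subr_ge0.
have h3 := ler_wpM2l yx0 h1.
have : ((y - x) * (1 - m) = (x + 1) * m - x)%R.
  by rewrite /m; field; rewrite gt_eqF.
rewrite /gfun; move: h2 h3 lnxy; rewrite mul1r.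
move: (ln x) (ln y) (ln _) (ln _) => a b c d; lra.
Qed.

(** Source of the term [D g]: clearing the denominator of the mixing weight [1 / (1 + d)] turns the
    defect [h2] into [gfun]. *)
Lemma gfun_h2 (R : realType) (d : R) : (0 < d)%R ->
  ((1 + d) * h2 (1 + d)^-1 = gfun d)%R.
Proof.
move=> d0; have d1 : (0 < 1 + d)%R by lra.
rewrite /h2 /gfun lnV ?posrE//.
have -> : (1 - (1 + d)^-1 = d / (1 + d))%R by field; rewrite gt_eqF.
rewrite ln_div ?posrE// (addrC d); move: (ln _) (ln _) => a b.
by field; rewrite gt_eqF.
Qed.

(** * Distributions, entropy and energy *)

Lemma esumZl (R : realType) (T : choiceType) (A : set T) (c : R)
    (a : T -> \bar R) : (0 <= c)%R -> (forall t, 0 <= a t) ->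
  \esum_(t in A) (c%:E * a t) = c%:E * \esum_(t in A) a t.
Proof.
move=> c0 a0; rewrite /esum -ereal_supZl//; last first.
  by apply/set0P; exists 0; exists set0; [exact: fsets_set0|rewrite fsbig_set0].
rewrite image_comp; congr ereal_sup; apply: eq_imagel => X _ /=.
by rewrite ge0_mule_fsumr.
Qed.

Lemma is_distr_le1 (R : realType) (I : choiceType) (p : I -> R) (i : I) :
  is_distr p -> (p i <= 1)%R.
Proof.
move=> [p0 p1]; rewrite -lee_fin -p1; apply: esum_ge; exists [set i].
  by split.
by rewrite fsbig_set1.
Qed.

Lemma entropy_term_ge0 (R : realType) (p : nat -> R) (i : nat) :
  is_distr p -> (0 <= - (p i * ln (p i)))%R.
Proof.
move=> hp; rewrite oppr_ge0 mulr_ge0_le0 ?ln_le0 ?is_distr_le1//.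
by case: hp.
Qed.

Lemma entropy_ge0 (R : realType) (p : nat -> R) : is_distr p -> 0 <= entropy p.
Proof.
move=> hp; apply: nneseries_ge0 => i _ _.
by rewrite lee_fin entropy_term_ge0.
Qed.

Lemma energy_ge0 (R : realType) (S : R^nat) (p : nat -> R) :
  (forall i, 0 <= S i)%R -> (forall i, 0 <= p i)%R -> 0 <= energy S p.
Proof.
by move=> S0 p0; apply: nneseries_ge0 => i _ _; rewrite lee_fin mulr_ge0.
Qed.

(* Sum of [- x ln x <= w - x + x s] for [w = e^-s]. *)
Lemma entropy_le_Gibbs (R : realType) (S : R^nat) (p : nat -> R) :
  (forall i, 0 <= S i)%R -> is_distr p ->
  entropy p <= \sum_(0 <= i <oo) (expR (- S i))%:E + energy S p.
Proof.
move=> S0 hp; have p0 := hp.1.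
rewrite /energy -nneseriesD; last 2 first.
- by move=> i _ _; rewrite lee_fin expR_ge0.
- by move=> i _ _; rewrite lee_fin mulr_ge0.
apply: lee_nneseries => [i _ _|i _]; first by rewrite lee_fin entropy_term_ge0.
rewrite -EFinD lee_fin.
have := ge_sub_xlnxy _ _ _ (p0 i) (expR_gt0 (- S i)).
rewrite expRK; have := p0 i; lra.
Qed.

Definition point_mass0 {R : realType} (i : nat) : R := (i == 0%N)%:R.

Lemma is_distr_point_mass0 (R : realType) : is_distr (@point_mass0 R).
Proof.
split=> [i|]; first exact: ler0n.
rewrite -(@esum_set1 R nat 0%N (fun=> 1)) ?lee01// [RHS]esum_mkcond.
apply: eq_esum => i _; rewrite /point_mass0.
case: eqVneq => [->|i0]; first by rewrite mem_set.
by rewrite memNset//= => /eqP; rewrite (negbTE i0).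
Qed.

Lemma is_distr_mix (R : realType) (I : choiceType) (t : R) (p q : I -> R) :
  (0 <= t <= 1)%R -> is_distr p -> is_distr q -> is_distr (mix t p q).
Proof.
move=> /andP[t0 t1] [p0 p1] [q0 q1].
have t1' : (0 <= 1 - t)%R by rewrite subr_ge0.
split=> [i|]; first by rewrite addr_ge0// mulr_ge0.
under eq_esum do rewrite /mix EFinD !EFinM.
rewrite esumD => [|i _|i _]; last 2 first.
- by rewrite -EFinM lee_fin mulr_ge0.
- by rewrite -EFinM lee_fin mulr_ge0.
rewrite !esumZl//; [|by move=> i; rewrite lee_fin..].
by rewrite p1 q1 !mule1 -EFinD addrC subrK.
Qed.

(** * The maximal entropy [FS] under an energy constraint *)

Section constrained_entropy.
Context {R : realType} (S : R^nat).
Hypotheses (S_ge0 : forall i, (0 <= S i)%R) (S_first : S 0%N = 0%R).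

Lemma energy_mix_point_mass0 (t : R) (p : nat -> R) : (0 <= t)%R ->
  (forall i, 0 <= p i)%R ->
  energy S (mix t p point_mass0) = t%:E * energy S p.
Proof.
move=> t0 p0; rewrite /energy -nneseriesZl; last first.
  by move=> i _; rewrite lee_fin mulr_ge0.
apply: eq_eseriesr => i _; rewrite -EFinM; congr EFin.
rewrite /mix /point_mass0; case: eqVneq => [->|_]; first by rewrite S_first; ring.
by rewrite mulr0 addr0 mulrCA.
Qed.

(** Concavity of entropy, term by term; the point mass itself has entropy zero. *)
Lemma entropy_mix_point_mass0 (t : R) (p : nat -> R) : (0 <= t <= 1)%R ->
  is_distr p -> t%:E * entropy p <= entropy (mix t p point_mass0).
Proof.
move=> t01 hp; have /andP[t0 t1] := t01; rewrite /entropy -nneseriesZl; last first.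
  by move=> i _; rewrite lee_fin entropy_term_ge0.
apply: lee_nneseries => [i _ _|i _]; rewrite -EFinM lee_fin.
  by rewrite mulr_ge0// entropy_term_ge0.
have y0 : (0 <= point_mass0 i :> R)%R by exact: ler0n.
have := convex_xlnx _ _ _ _ t01 (hp.1 i) y0.
have -> : (point_mass0 i * ln (point_mass0 i) = 0 :> R)%R.
  by rewrite /point_mass0; case: (i == _); rewrite ?mul0r// ln1 mulr0.
by rewrite /mix mulr0 addr0 mulrN lerN2.
Qed.

Lemma le_FS (X Y : \bar R) : X <= Y -> FS S X <= FS S Y.
Proof.
move=> XY; apply: ereal_sup_le => _ [p [hp pX] <-].
exists p => //; split=> //; exact: le_trans XY.
Qed.

Lemma entropy_le_FS (X : \bar R) (p : nat -> R) :
  is_distr p -> energy S p <= X -> entropy p <= FS S X.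
Proof. by move=> hp pX; apply: ereal_sup_ubound; exists p. Qed.

Lemma FS_ge0 (X : \bar R) : 0 <= X -> 0 <= FS S X.
Proof.
move=> X0; have hp := is_distr_point_mass0 R.
apply: le_trans (entropy_ge0 _ _ hp) _; apply: entropy_le_FS => //.
rewrite /energy eseries0// => i _ _; rewrite /point_mass0.
by case: eqVneq => [->|_]; rewrite ?S_first ?mul0r ?mulr0.
Qed.

(** A competitor for [X / d], mixed with weight [d / e] against the point mass, has energy at most
    [X / e] and keeps at least the fraction [d / e] of its entropy. *)
Lemma FS_scale (d e X : R) : (0 < d)%R -> (d <= e)%R ->
  d%:E * FS S (X / d)%:E <= e%:E * FS S (X / e)%:E.
Proof.
move=> d0 de; have e0 := lt_le_trans d0 de.
have de01 : (0 <= d / e <= 1)%R.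
  by rewrite (divr_ge0 (ltW d0) (ltW e0)) ler_pdivrMr// mul1r.
rewrite -lee_pdivlMl//; apply: ge_ereal_sup => _ [p [hp pX] <-].
rewrite lee_pdivlMl// -lee_pdivrMl// muleA -EFinM [(_^-1 * d)%R]mulrC.
apply: le_trans (entropy_mix_point_mass0 _ _ de01 hp) _.
apply: entropy_le_FS.
  exact: is_distr_mix de01 hp (is_distr_point_mass0 _).
have /andP[de0 _] := de01; rewrite energy_mix_point_mass0//; last exact: hp.1.
apply: le_trans (lee_wpmul2l _ pX) _; first by rewrite lee_fin.
rewrite -EFinM lee_fin le_eqVlt; apply/orP; left; apply/eqP.
by field; rewrite !gt_eqF.
Qed.

(** Gibbs' inequality bounds every competitor by the same number, the Gibbs sum plus [X]. *)
Lemma FS_fin_num (X : R) :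
  \sum_(0 <= i <oo) (expR (- S i))%:E < +oo -> (0 <= X)%R ->
  FS S X%:E \is a fin_num.
Proof.
move=> S_Gibbs X0; rewrite ge0_fin_numE ?FS_ge0//.
apply: le_lt_trans (lte_add_pinfty S_Gibbs (ltry X)).
apply: ge_ereal_sup => _ [p [hp pX] <-].
apply: le_trans (entropy_le_Gibbs _ _ _ S_ge0 hp) _.
by rewrite leeD2l.
Qed.

End constrained_entropy.

(** * First marginals and the Jordan parts of [p - q] *)

Section marginal.
Context {R : realType} {n : nat}.
Implicit Types (S : R^nat) (p u : n.+1.-tuple nat -> R).

Lemma marginal1_ge0 p : (forall t, 0 <= p t)%R ->
  forall i, (0 <= marginal1 p i)%R.
Proof.
by move=> p0 i; apply/fine_ge0/esum_ge0 => t _; rewrite lee_fin.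
Qed.

(** Regroups the sum by first coordinate. Summability of [p] makes each fibre sum finite, so the
    [fine] in [marginal1] loses nothing. *)
Lemma energy_marginal1 S p : (forall i, 0 <= S i)%R -> (forall t, 0 <= p t)%R ->
  \esum_(t in [set: n.+1.-tuple nat]) (p t)%:E < +oo ->
  energy S (marginal1 p) =
  \esum_(t in [set: n.+1.-tuple nat]) (S (thead t) * p t)%:E.
Proof.
move=> S0 p0 p_fin; pose J i := [set t : n.+1.-tuple nat | thead t = i].
have -> : [set: n.+1.-tuple nat] = \bigcup_i J i.
  by apply/seteqP; split=> // t _; exists (thead t).
rewrite nneseries_sum_bigcup; last 2 first.
- by move=> i j _ _ [t []]; rewrite /J /= => <- <-.
- by move=> t; rewrite lee_fin mulr_ge0.
apply: eq_eseriesr => i _; rewrite /marginal1 EFinM fineK; last first.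
  rewrite ge0_fin_numE ?esum_ge0//; last by move=> t _; rewrite lee_fin.
  apply: le_lt_trans p_fin; rewrite esum_mkcond; apply: le_esum => t _.
  by case: ifP; rewrite lee_fin.
rewrite -esumZl//.
by apply: eq_esum => t <-; rewrite EFinM.
Qed.

Lemma is_distr_marginal1 p : is_distr p -> is_distr (marginal1 p).
Proof.
move=> [p0 p1]; split; first exact: marginal1_ge0.
rewrite -nneseries_esumT; last by move=> i; rewrite lee_fin marginal1_ge0.
(* With all energy levels equal to 1, the energy is the total mass. *)
have := energy_marginal1 (fun=> 1%R) p (fun=> ler01) p0.
rewrite p1 ltry => /(_ isT); rewrite /energy.
under eq_eseriesr do rewrite mul1r.
by move=> ->; under eq_esum do rewrite mul1r.
Qed.

Lemma TVC p q : TV p q = TV q p.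
Proof.
by rewrite /TV; congr (_ * fine _)%R; apply: eq_esum => t _; rewrite distrC.
Qed.

(* For [TV p q = 0] the junk value [0^-1 = 0] makes [jordan_part p q] zero. *)
Lemma jordan_part_TV_gt0 p q : is_distr (jordan_part p q) -> (0 < TV p q)%R.
Proof.
move=> [_ j1]; rewrite lt_neqAle; apply/andP; split.
  apply/eqP => TV0; move: j1; rewrite esum1 => [/eqP|t _].
    by rewrite eq_sym onee_eq0.
  by rewrite /jordan_part -TV0 invr0 mul0r.
by rewrite /TV mulr_ge0// fine_ge0// esum_ge0// => t _; rewrite lee_fin.
Qed.

(** The entries of the normalized positive part are at most 1. This pointwise bound makes the cutoff
    at [eps] compatible with [TV p q <= eps]. *)
Lemma sub_le_TV p q t : is_distr (jordan_part p q) -> (p t - q t <= TV p q)%R.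
Proof.
move=> hj; have d0 := jordan_part_TV_gt0 _ _ hj.
have := is_distr_le1 _ _ _ t hj.
rewrite /jordan_part ler_pdivrMl// mulr1.
by apply: le_trans; rewrite le_max lexx.
Qed.

(* Both sides are [(1 + TV p q)^-1 * max (p t) (q t)]. *)
Lemma mix_jordan_part p q : (0 < TV p q)%R ->
  mix (1 + TV p q)^-1%R p (jordan_part q p) =
  mix (1 + TV p q)^-1%R q (jordan_part p q).
Proof.
move=> d0; apply/funext => t; rewrite /mix /jordan_part (TVC q p).
have d1 : (1 + TV p q)%R != 0%R by rewrite gt_eqF// addr_gt0.
have h x : ((1 - (1 + TV p q)^-1) * ((TV p q)^-1 * x) = (1 + TV p q)^-1 * x)%R.
  by field; rewrite d1 gt_eqF.
rewrite !h -!mulrDr; congr (_ * _)%R.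
by case: (leP (q t - p t)%R 0%R); case: (leP (p t - q t)%R 0%R); lra.
Qed.

(** [TV p q] times the Jordan part is [[p - q]_+], so [u] and this part fit together below [p], and
    energy is additive and monotone. The array [u] is later the cutoff of [p]. *)
Lemma energy_jordan_part S p q u : (forall i, 0 <= S i)%R ->
  is_distr p -> is_distr (jordan_part p q) ->
  (forall t, 0 <= u t)%R ->
  (forall t, u t + Num.max (p t - q t) 0 <= p t)%R ->
  energy S (marginal1 u) + (TV p q)%:E * energy S (marginal1 (jordan_part p q))
    <= energy S (marginal1 p).
Proof.
move=> S0 hp hj u0 up; have d0 := jordan_part_TV_gt0 _ _ hj.
have fin v : (forall t, v t <= p t)%R ->
    \esum_(t in [set: n.+1.-tuple nat]) (v t)%:E < +oo.
  move=> vp; apply: (@le_lt_trans _ _ 1); last exact: ltry.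
  by rewrite -hp.2; apply: le_esum => t _; rewrite lee_fin.
have m0 t : (0 <= Num.max (p t - q t) 0)%R by rewrite le_max lexx orbT.
rewrite !energy_marginal1//; [|exact: hp.1|exact: fin|exact: hj.1| |]; last 2 first.
- by rewrite hj.2 ltry.
- by apply: fin => t; apply: le_trans (up t); rewrite lerDl.
rewrite -esumZl; [|exact: ltW|]; last first.
  by move=> t; rewrite lee_fin mulr_ge0// hj.1.
rewrite -esumD; last 2 first.
- by move=> t _; rewrite lee_fin mulr_ge0.
- move=> t _; rewrite -EFinM lee_fin (mulr_ge0 (ltW d0))//.
  by rewrite mulr_ge0// hj.1.
apply: le_esum => t _; rewrite -EFinM -EFinD lee_fin mulrCA -mulrDr.
by rewrite ler_wpM2l// /jordan_part mulrA divff ?gt_eqF// mul1r.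
Qed.

(** When both positive parts are active the sum is [p t - eps + (p t - q t)], which is where
    [p t - q t <= eps] enters; the other cases follow from the signs of [p t], [q t] and [eps]. *)
Lemma cutoff_add_le p q (eps : R) t : (0 < eps)%R -> (forall t, 0 <= p t)%R ->
  (forall t, 0 <= q t)%R -> (p t - q t <= eps)%R ->
  (cutoff eps p t + Num.max (p t - q t) 0 <= p t)%R.
Proof.
move=> e0 /(_ t) p0 /(_ t) q0 pq; rewrite /cutoff.
by case: (leP (p t - q t)%R 0%R); case: (leP (p t - eps)%R 0%R); lra.
Qed.

End marginal.

(** The Alicki-Fannes-Winter technique. At the Jordan parts only the one-sided bounds [a] and [b]
    enter, so [f (jordan_part q p)] may be infinite. *)
Lemma T1class_AFW (R : realType) (n : nat) (f : (n.+1.-tuple nat -> R) -> \bar R)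
    (dm dp a b x y : R) (p q : n.+1.-tuple nat -> R) :
  let lam := (1 + TV p q)^-1%R in
  (0 < TV p q)%R ->
  f p = x%:E -> f q = y%:E ->
  f (jordan_part p q) <= a%:E -> b%:E <= f (jordan_part q p) ->
  lam%:E * f p + (1 - lam)%:E * f (jordan_part q p) - (dm * h2 lam)%:E
    <= f (mix lam p (jordan_part q p)) ->
  f (mix lam q (jordan_part p q))
    <= lam%:E * f q + (1 - lam)%:E * f (jordan_part p q) + (dp * h2 lam)%:E ->
  (x - y <= TV p q * (a - b) + (dm + dp) * gfun (TV p q))%R.
Proof.
move=> lam d0 fp fq fa fb lo up.
have lam0 : (0 <= 1 - lam)%R.
  by rewrite /lam subr_ge0 invf_le1; lra.
have : lam%:E * x%:E + (1 - lam)%:E * b%:E - (dm * h2 lam)%:E <=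
    lam%:E * y%:E + (1 - lam)%:E * a%:E + (dp * h2 lam)%:E.
  apply: (@le_trans _ _ (f (mix lam p (jordan_part q p)))).
    apply: le_trans lo; rewrite fp leeD2r// leeD2l// lee_wpmul2l//.
  rewrite mix_jordan_part//; apply: (le_trans up).
  by rewrite fq leeD2r// leeD2l// lee_wpmul2l.
rewrite -!EFinM -!EFinD lee_fin -gfun_h2//.
have d1 : (0 < 1 + TV p q)%R by lra.
rewrite -/lam; move: (h2 lam) => h.
(* Multiplying by [1 + TV p q] turns the weights [lam] and [1 - lam] into 1 and [TV p q]. *)
move=> /(ler_wpM2l (ltW d1)).
have lamK : ((1 + TV p q) * lam = 1)%R by rewrite divff// gt_eqF.
have -> z : ((1 + TV p q) * (lam * x + (1 - lam) * b + z) =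
  x + TV p q * b + (1 + TV p q) * z)%R.
  by rewrite /lam; field; rewrite gt_eqF.
have -> z : ((1 + TV p q) * (lam * y + (1 - lam) * a + z) =
  y + TV p q * a + (1 + TV p q) * z)%R.
  by rewrite /lam; field; rewrite gt_eqF.
nra.
Qed.

(** * Entropy bounds for Jordan parts under the energy constraint *)

Section continuity_bound.
Context {R : realType} {n : nat} (S : R^nat) (eps : R).
Hypotheses (S_ge0 : forall i, (0 <= S i)%R) (S_first : S 0%N = 0%R).
Hypothesis S_Gibbs : \sum_(0 <= i <oo) (expR (- S i))%:E < +oo.
Hypothesis eps_gt0 : (0 < eps)%R.
Implicit Types p q : n.+1.-tuple nat -> R.

Lemma entropy_marginal1_fin_num p (E : R) : is_distr p ->
  energy S (marginal1 p) <= E%:E -> entropy (marginal1 p) \is a fin_num.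
Proof.
move=> /is_distr_marginal1 hp pE; rewrite ge0_fin_numE ?entropy_ge0//.
apply: le_lt_trans (entropy_le_Gibbs _ S _ S_ge0 hp) _.
by rewrite lte_add_pinfty// (le_lt_trans pE)// ltry.
Qed.

Lemma Eeps_le_energy p : is_distr p ->
  0 <= Eeps S eps p <= energy S (marginal1 p).
Proof.
move=> [p0 p1]; have c0 t : (0 <= cutoff eps p t)%R by rewrite le_max lexx orbT.
have cp t : (cutoff eps p t <= p t)%R.
  by rewrite /cutoff ge_max p0 andbT gerBl ltW.
apply/andP; split; first exact/energy_ge0/marginal1_ge0.
rewrite /Eeps !energy_marginal1//; last 2 first.
- by rewrite p1 ltry.
- apply: (@le_lt_trans _ _ 1); last exact: ltry.
  by rewrite -p1; apply: le_esum => t _; rewrite lee_fin.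
by apply: le_esum => t _; rewrite lee_fin ler_wpM2l.
Qed.

(** The cutoff of [p] uses [x] of the energy budget [E], which leaves [(E - x) / TV p q] for the
    Jordan part; [FS_scale] then passes from [TV p q] to [eps]. *)
Lemma entropy_jordan_part p q (E x : R) :
  is_distr p -> is_distr q -> is_distr (jordan_part p q) ->
  energy S (marginal1 p) <= E%:E -> (TV p q <= eps)%R ->
  Eeps S eps p = x%:E ->
  entropy (marginal1 (jordan_part p q)) \is a fin_num /\
  (TV p q)%:E * entropy (marginal1 (jordan_part p q))
    <= eps%:E * FS S ((E - x) / eps)%:E.
Proof.
move=> hp hq hj pE pq pEeps; have d0 := jordan_part_TV_gt0 _ _ hj.
have : x%:E + (TV p q)%:E * energy S (marginal1 (jordan_part p q)) <= E%:E.
  apply: le_trans pE; rewrite -pEeps; apply: energy_jordan_part => // t.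
    by rewrite le_max lexx orbT.
  apply: cutoff_add_le => //; [exact: hp.1|exact: hq.1|].
  exact: le_trans (sub_le_TV _ _ _ hj) pq.
rewrite -leeBrDl// -EFinB -lee_pdivlMl// -EFinM mulrC => jE; split.
  exact: entropy_marginal1_fin_num hj jE.
apply: le_trans _ (FS_scale S S_ge0 S_first _ _ _ d0 pq).
rewrite lee_wpmul2l ?lee_fin ?(ltW d0)//.
exact: entropy_le_FS S _ _ (is_distr_marginal1 _ hj) jE.
Qed.

End continuity_bound.

Theorem proposition6 (R : realType) (n : nat)
    (P0 : set (n.+1.-tuple nat -> R))
    (P0_distr : forall p, P0 p -> is_distr p)
    (P0_convex : @convex_set R (n.+1.-tuple nat -> R^o) P0)
    (P0_Delta : forall p q, P0 p -> P0 q -> p <> q ->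
      P0 (jordan_part p q) /\ P0 (jordan_part q p))
    (S : R^nat)
    (S_nondecreasing : nondecreasing_seq S)
    (S_ge0 : forall i, (0 <= S i)%R)
    (S_first : S 0%N = 0%R)
    (S_Gibbs : forall beta : R, (0 < beta)%R ->
      \sum_(0 <= i <oo) (expR (- (beta * S i)))%:E < +oo)
    (eps : R) (eps_gt0 : (0 < eps)%R) :
  (forall (C D : R) (f : (n.+1.-tuple nat -> R) -> \bar R),
    T1class C D P0 f ->
    forall (E : R) (p q : n.+1.-tuple nat -> R),
      P0 p -> P0 q ->
      energy S (marginal1 p) <= E%:E ->
      energy S (marginal1 q) <= E%:E ->
      (TV p q <= eps)%R ->
      `|f p - f q| <=
        (C * eps)%:E * FS S (E / eps)%:E + (D * gfun eps)%:E)
  /\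
  (forall (C D : R) (f : (n.+1.-tuple nat -> R) -> \bar R),
    T1class C D P0 f ->
    (forall p, P0 p -> 0 <= f p) ->
    forall (E : R) (p : n.+1.-tuple nat -> R),
      P0 p ->
      energy S (marginal1 p) <= E%:E ->
      forall q : n.+1.-tuple nat -> R,
        P0 q ->
        (TV p q <= eps)%R ->
        f p - f q <=
          (C * eps)%:E * FS S ((E%:E - Eeps S eps p) * (eps^-1)%:E)
            + (D * gfun eps)%:E /\
        (C * eps)%:E * FS S ((E%:E - Eeps S eps p) * (eps^-1)%:E)
            + (D * gfun eps)%:E
          <= (C * eps)%:E * FS S (E / eps)%:E + (D * gfun eps)%:E).
Proof.
have Gibbs1 : \sum_(0 <= i <oo) (expR (- S i))%:E < +oo.
  by have := S_Gibbs 1%R ltr01; under eq_eseriesr do rewrite mul1r.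
have eps0 := ltW eps_gt0.
have energy_p0 p : P0 p -> 0 <= energy S (marginal1 p).
  by move=> /P0_distr[p0 _]; exact/energy_ge0/marginal1_ge0.
have Eeps_num p (E : R) : P0 p -> energy S (marginal1 p) <= E%:E ->
    exists x : R, Eeps S eps p = x%:E /\ (0 <= x <= E)%R.
  move=> /P0_distr hp pE.
  have /andP[x0 xE] := Eeps_le_energy S _ S_ge0 eps_gt0 _ hp.
  have {}xE := le_trans xE pE.
  have /fineK xK : Eeps S eps p \is a fin_num.
    by rewrite ge0_fin_numE// (le_lt_trans xE) ?ltry.
  by exists (fine (Eeps S eps p)); rewrite xK -!lee_fin xK x0 xE.
have lam01 (d : R) : (0 < d)%R -> (0 <= (1 + d)^-1 <= 1)%R.
  by move=> d0; rewrite invr_ge0 invf_le1; lra.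
(* Finite energy gives finite entropy of the first marginal, and the upper entropy bound then
   excludes the value [+oo]. *)
have f_num f C D p (E : R) : T1class C D P0 f -> P0 p ->
    energy S (marginal1 p) <= E%:E -> exists x, f p = x%:E.
  move=> [fNy [cm [cp [dm [dp [_ [_ [_ [_ bd]]]]]]]]] Pp pE.
  have [_ fle] := bd _ Pp.
  have /fineK hK := entropy_marginal1_fin_num S S_ge0 Gibbs1 _ _ (P0_distr _ Pp) pE.
  exists (fine (f p)); rewrite fineK// fin_numE fNy//=.
  by apply: contraTneq fle => ->; rewrite -hK -EFinM leye_eq.
have FS_num (x E : R) : (x <= E)%R -> exists F : R,
    FS S ((E - x) / eps)%:E = F%:E /\ (0 <= F)%R.
  move=> xE; have X0 : (0 <= (E - x) / eps)%R by rewrite divr_ge0// subr_ge0.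
  have /fineK FK := FS_fin_num S S_ge0 S_first _ Gibbs1 X0.
  exists (fine (FS S ((E - x) / eps)%:E)); split=> //.
  by rewrite fine_ge0// FS_ge0// lee_fin.
have FS_Eeps (x E : R) : (0 <= x)%R ->
    FS S ((E - x) / eps)%:E <= FS S (E / eps)%:E.
  move=> x0; apply: le_FS; rewrite lee_fin ler_pM2r ?invr_gt0//.
  by rewrite gerBl.
split=> C D f fT1.
  (* The hypotheses of A are symmetric in [p] and [q], so a one-sided bound used twice gives the
     absolute value. *)
  have main p q (E : R) : P0 p -> P0 q -> energy S (marginal1 p) <= E%:E ->
      energy S (marginal1 q) <= E%:E -> (TV p q <= eps)%R ->
      f p - f q <= (C * eps)%:E * FS S (E / eps)%:E + (D * gfun eps)%:E.
    move=> Pp Pq pE qE pq.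
    have [x fp] := f_num _ _ _ _ _ fT1 Pp pE.
    have [y fq] := f_num _ _ _ _ _ fT1 Pq qE.
    have [u [pu /andP[u0 uE]]] := Eeps_num _ _ Pp pE.
    have [v [qv /andP[v0 vE]]] := Eeps_num _ _ Pq qE.
    have E0 : (0 <= E)%R by lra.
    have [F []] := FS_num 0%R E E0; rewrite subr0 => FE F0.
    have geps0 := gfun_ge0 _ _ eps_gt0.
    have [fNy [cm [cp [dm [dp [[cm0 cp0 dm0 dp0] [CE [DE [cvx bd]]]]]]]]] := fT1.
    rewrite fp fq FE -EFinM -EFinD lee_fin -CE -DE.
    (* For [p = q] there are no Jordan distributions; the left side is 0 and the right side
       nonnegative. *)
    have [pq_eq|/eqP pq_neq] := eqVneq p q.
      have : f p = f q by rewrite pq_eq.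
      rewrite fp fq => -[->]; rewrite subrr addr_ge0// mulr_ge0// ?addr_ge0//.
      by rewrite mulr_ge0// addr_ge0.
    have [Pj Pj'] := P0_Delta _ _ Pp Pq pq_neq.
    have hj := P0_distr _ Pj; have hj' := P0_distr _ Pj'.
    have d0 := jordan_part_TV_gt0 _ _ hj.
    have [/fineK hK hF] := entropy_jordan_part S _ S_ge0 S_first Gibbs1 eps_gt0
      _ _ _ _ (P0_distr _ Pp) (P0_distr _ Pq) hj pE pq pu.
    have [/fineK hK' hF'] := entropy_jordan_part S _ S_ge0 S_first Gibbs1 eps_gt0
      _ _ _ _ (P0_distr _ Pq) (P0_distr _ Pp) hj' qE
      (eq_ind _ (fun z => z <= eps)%R pq _ (TVC p q)) qv.
    (* The gains [u] and [v] from the cutoffs are dropped, leaving the common bound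
       [FS S (E / eps)]. *)
    have {}hF := le_trans hF (lee_wpmul2l _ (FS_Eeps _ _ u0)).
    have {}hF' := le_trans hF' (lee_wpmul2l _ (FS_Eeps _ _ v0)).
    move: hF hF' hK hK'; rewrite FE !lee_fin => /(_ eps0) + /(_ eps0).
    rewrite (TVC q p).
    have [_ fj] := bd _ Pj; have [fj' _] := bd _ Pj'.
    move: fj fj'.
    set h := entropy _; set h' := entropy _; move=> fj fj' + + hK hK'.
    move: fj fj'; rewrite -hK -hK'; move: (fine h) (fine h') => {hK hK'}h {}h'.
    rewrite -!EFinM -EFinN !lee_fin => fj fj' hF hF'.
    have [lo _] := cvx _ _ _ Pp Pj' (lam01 _ d0).
    have [_ up] := cvx _ _ _ Pq Pj (lam01 _ d0).
    have /= := T1class_AFW _ _ _ _ _ _ _ _ _ _ _ d0 fp fq fj fj' lo up.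
    have gle := le_gfun _ _ _ d0 pq.
    have dD0 : (0 <= dm + dp)%R by rewrite addr_ge0.
    have := ler_wpM2l dD0 gle.
    (* The entropies of the two Jordan parts carry the weights [cp] and [cm], which add up to
       [C]. *)
    have := ler_wpM2l cp0 hF; have := ler_wpM2l cm0 hF'.
    move: (gfun _) (gfun _) => g1 g2; nra.
  move=> E p q Pp Pq pE qE pq.
  have hpq := main p q E Pp Pq pE qE pq.
  rewrite TVC in pq.
  have := main q p E Pq Pp qE pE pq.
  move: hpq; have [x ->] := f_num _ _ _ _ _ fT1 Pp pE.
  have [y ->] := f_num _ _ _ _ _ fT1 Pq qE.
  case: (_ * FS _ _ + _) => [z| |]; rewrite -!EFinB.
  - by rewrite abse_EFin !lee_fin ler_norml => h1 h2; apply/andP; split; lra.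
  - by move=> _ _; rewrite leey.
  - by rewrite leeNy_eq.
move=> f0 E p Pp pE q Pq pq.
have [u [pu /andP[u0 uE]]] := Eeps_num _ _ Pp pE.
have [fNy [cm [cp [dm [dp [[cm0 cp0 dm0 dp0] [CE [DE [cvx bd]]]]]]]]] := fT1.
rewrite pu -EFinB -EFinM; split; last first.
  by rewrite leeD2r// lee_wpmul2l// ?FS_Eeps// lee_fin -CE mulr_ge0// addr_ge0.
have [F [FE F0]] := FS_num _ _ uE.
have [x fp] := f_num _ _ _ _ _ fT1 Pp pE.
have geps0 := gfun_ge0 _ _ eps_gt0.
rewrite FE fp -EFinM -EFinD -CE -DE.
(* The energy of [q] is not bounded here: [f q = +oo] makes the left side [-oo]. *)
case fq : (f q) => [y| |]; [|by rewrite leNye|by have := fNy _ Pq; rewrite fq].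
rewrite lee_fin.
have [pq_eq|/eqP pq_neq] := eqVneq p q.
  have : f p = f q by rewrite pq_eq.
  rewrite fp fq => -[->]; rewrite subrr addr_ge0// mulr_ge0// ?addr_ge0//.
  by rewrite mulr_ge0// addr_ge0.
have [Pj Pj'] := P0_Delta _ _ Pp Pq pq_neq.
have hj := P0_distr _ Pj; have d0 := jordan_part_TV_gt0 _ _ hj.
have [/fineK hK hF] := entropy_jordan_part S _ S_ge0 S_first Gibbs1 eps_gt0
  _ _ _ _ (P0_distr _ Pp) (P0_distr _ Pq) hj pE pq pu.
move: hF; have [_ fj] := bd _ Pj; rewrite FE -hK -!EFinM lee_fin => hF.
move: fj; rewrite -hK -EFinM => fj.
have [lo _] := cvx _ _ _ Pp Pj' (lam01 _ d0).
have [_ up] := cvx _ _ _ Pq Pj (lam01 _ d0).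
(* Nonnegativity of [f] supplies the lower bound 0 at [jordan_part q p], in place of an entropy
   bound that would require the energy of [q]. *)
have /= := T1class_AFW _ _ _ _ _ _ _ _ _ _ _ d0 fp fq fj (f0 _ Pj') lo up.
have dD0 : (0 <= dm + dp)%R by rewrite addr_ge0.
have := ler_wpM2l dD0 (le_gfun _ _ _ d0 pq).
(* Only [cp] arises from the estimate; the nonnegative term [cm * (eps * F)] raises it to [C]. *)
have := ler_wpM2l cp0 hF; have := mulr_ge0 cm0 (mulr_ge0 eps0 F0).
move: (gfun _) (gfun _) (fine _) => g1 g2 h; nra.
Qed.
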